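(* Let $\mathcal{M}$ be a matroid with set of bases $\mathcal{B}$. Then $\mathcal{M}$ is binary if and only if $\Delta_{\{B_1,B_2\}}\neq 3$ for every $B_1,B_2\in\mathcal{B}$.
   Context: A matroid is binary if it is representable over the field with two elements. For bases $B_1,B_2$ of $\mathcal{M}$, $\Delta_{\{B_1,B_2\}}$ is the number of unordered pairs $\{D_1,D_2\}$ with $D_1,D_2\in\mathcal{B}$ such that $D_1\cup D_2=B_1\cup B_2$ as multisets. *)

(* Defs.v *)
From HB Require Import structures.
From mathcomp Require Import all_boot all_order all_algebra.
Set Implicit Arguments. Unset Strict Implicit. Unset Printing Implicit Defensive.
Import GRing.Theory.

Definition is_matroid_bases (T : finType) (B : {set {set T}}) : Prop :=
  B != set0 /\
  forall B1 B2, B1 \in B -> B2 \in B ->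
    forall x, x \in B1 :\: B2 ->
      exists2 y, y \in B2 :\: B1 & y |: (B1 :\ x) \in B.

Definition rows_of (T : finType) (F : fieldType) (r : nat)
    (v : T -> 'rV[F]_r) (S : {set T}) : 'M[F]_(#|S|, r) :=
  \matrix_(i < #|S|, j < r) v (enum_val i) ord0 j.

Definition vec_bases (T : finType) (F : fieldType) (r : nat)
    (v : T -> 'rV[F]_r) : {set {set T}} :=
  [set S : {set T} | row_free (rows_of v S) &&
                     (\rank (rows_of v S) == \rank (rows_of v setT))].

Definition binary (T : finType) (B : {set {set T}}) : Prop :=
  exists (r : nat) (v : T -> 'rV['F_2]_r), B = vec_bases v.

Definition multiset_union_eq (T : finType) (D1 D2 B1 B2 : {set T}) : bool :=
  [forall x, ((x \in D1) + (x \in D2) == (x \in B1) + (x \in B2))%N].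

(* Δ_{B1,B2}: number of unordered pairs {D1,D2} (D1 = D2 allowed) of bases
   with D1 ∪ D2 = B1 ∪ B2 as multisets; an unordered pair is encoded as the
   set [set D1; D2]. *)
Definition Delta (T : finType) (B : {set {set T}}) (B1 B2 : {set T}) : nat :=
  #|[set [set D1; D2] | D1 in B, D2 in B & multiset_union_eq D1 D2 B1 B2]|.

(* Main.v *)
(* Both conditions say that no minor is U_{2,4}, i.e. that there are no set J and
   elements a, b, c, d outside J such that J plus any two of them is a basis.
   If |B1 \ B2| = 2, the pairs counted by Delta are among the three splittings
   of B1 + B2 = J + J + {a, b, c, d}, so Delta = 3 exactly when all six such
   bases occur; if |B1 \ B2| <= 1 then Delta = 1, and if |B1 \ B2| >= 3
   symmetric exchange of each element of B1 \ B2 already yields more than three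
   pairs.  A U_{2,4} minor is impossible over F_2, whose projective line has only
   three points.  Conversely, compare B with the matroid N given by the
   fundamental circuits of a basis X: a basis Z of one of them at distance k >= 2
   from X can be written J + z + z' with J + b + b' a basis at distance k - 2,
   and the four sets J + {z or z'} + {b or b'} are at distance k - 1.  Exchange
   together with the absence of U_{2,4} makes exactly one of the two splittings
   of these four sets consist of bases, in both matroids, and this forces Z to
   be a basis of the other matroid too. *)
Require Import Defs.
From mathcomp Require Import all_boot all_order all_algebra.
Set Implicit Arguments. Unset Strict Implicit. Unset Printing Implicit Defensive.
Import GRing.Theory.

(** * Basis exchange, freeness from U_{2,4}, and uniqueness of a matroid given its bases next to one
    basis *)

Section Matroids.

Variable T : finType.
Implicit Types (B : {set {set T}}) (J S X Y Z : {set T}) (a b c d x y z : T).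

Lemma card_exchange S x y : x \in S -> y \notin S -> #|y |: S :\ x| = #|S|.
Proof.
move=> xS yS; rewrite cardsU1 !inE (negPf yS) andbF /=.
by rewrite (cardsD1 x S) xS.
Qed.

Lemma setD_exchange S Z x y : y \in Z -> (y |: S :\ x) :\: Z = (S :\: Z) :\ x.
Proof.
move=> yZ; apply/setP=> w; rewrite !inE.
by case: (eqVneq w y) => [->|_]; rewrite ?yZ /= ?andbF //; case: (w \in Z); rewrite ?andbF.
Qed.

(** Each exchange keeps the size of [B1] and shrinks [B1 :\: B2]. Once that difference is empty, so
    is [B2 :\: B1], since an exchange of one of its elements would find no partner. *)
Lemma card_bases B (B1 B2 : {set T}) :
  is_matroid_bases B -> B1 \in B -> B2 \in B -> #|B1| = #|B2|.
Proof.
case=> _ exch; have [n] := ubnP #|B1 :\: B2|; elim: n => // n IHn in B1 B2 *.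
move=> lt_n B1B B2B; have [D0|[x xD]] := set_0Vmem (B1 :\: B2).
  have [D0'|[x xD]] := set_0Vmem (B2 :\: B1).
    by congr #|pred_of_set _|; apply/eqP; rewrite eqEsubset -!setD_eq0 D0 D0' eqxx.
  by have [y] := exch _ _ B2B B1B _ xD; rewrite D0 inE.
have [y yD yB] := exch _ _ B1B B2B _ xD.
move: (xD) (yD); rewrite !inE => /andP[xB2 xB1] /andP[yB1 yB2].
rewrite -(card_exchange xB1 yB1); apply: IHn => //.
by rewrite setD_exchange //; move: lt_n; rewrite (cardsD1 x) xD.
Qed.

Lemma set2C a b : [set a; b] = [set b; a].
Proof. exact: setUC. Qed.

Lemma card_setU2 J a b :
  a \notin J -> b \notin J -> a != b -> #|J :|: [set a; b]| = #|J|.+2.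
Proof.
move=> aJ bJ ab; rewrite setUC -setUA !cardsU1 !inE (negPf ab) (negPf aJ).
by rewrite (negPf bJ).
Qed.

(** Exchange [a] out of the first basis: the incoming element lies in the second basis but not in
    [J], so it is [c] or [d]. *)
Lemma pair_exchange1 B J a b c d : is_matroid_bases B ->
  a \notin J -> a != b -> a != c -> a != d ->
  J :|: [set a; b] \in B -> J :|: [set c; d] \in B ->
  (J :|: [set b; c] \in B) || (J :|: [set b; d] \in B).
Proof.
case=> _ exch aJ ab ac ad abB cdB.
have [|y] := exch _ _ abB cdB a.
  by rewrite !inE eqxx (negPf aJ) (negPf ac) (negPf ad) orbT.
rewrite !inE => /andP[ny yy].
have -> : y |: (J :|: [set a; b]) :\ a = J :|: [set b; y].
  apply/setP=> w; rewrite !inE; case: (eqVneq w a) => [->|_] /=.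
    by rewrite (negPf aJ) (negPf ab) /= !orbF.
  by rewrite orbC -orbA.
move: ny yy; rewrite negb_or => /andP[/negPf-> _] /= yy yB.
by case/orP: yy yB => /eqP-> ->; rewrite ?orbT.
Qed.

Definition four_outside J a b c d :=
  uniq [:: a; b; c; d] && all [predC J] [:: a; b; c; d].

Lemma four_outsideP J a b c d : four_outside J a b c d ->
  [/\ [/\ a != b, a != c, a != d, b != c & b != d] /\ c != d,
   a \notin J, b \notin J, c \notin J & d \notin J].
Proof.
rewrite /four_outside /= !inE !negb_or !andbT -!andbA.
by do 9 case/andP=> ?; move=> ?; split.
Qed.

(** Exchanging out each of the four elements shows that, in the 4-cycle with edges ac, cb, bd, da,
    every vertex lies on an edge giving a basis. Such a set of edges contains one of the two perfect
    matchings. *)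
Lemma pair_exchange B J a b c d : is_matroid_bases B -> four_outside J a b c d ->
  J :|: [set a; b] \in B -> J :|: [set c; d] \in B ->
  (J :|: [set a; c] \in B) && (J :|: [set b; d] \in B) ||
  (J :|: [set a; d] \in B) && (J :|: [set b; c] \in B).
Proof.
move=> mB /four_outsideP[[[ab ac ad bc bd] cd] aJ bJ cJ dJ] abB cdB.
have ba : b != a by rewrite eq_sym.
have [ca cb] : c != a /\ c != b by rewrite ![c == _]eq_sym.
have [da db dc] : [/\ d != a, d != b & d != c] by rewrite ![d == _]eq_sym.
have baB : J :|: [set b; a] \in B by rewrite set2C.
have dcB : J :|: [set d; c] \in B by rewrite set2C.
have := pair_exchange1 mB aJ ab ac ad abB cdB.
have := pair_exchange1 mB bJ ba bc bd baB cdB.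
have := pair_exchange1 mB cJ cd ca cb cdB abB.
have := pair_exchange1 mB dJ dc da db dcB abB.
rewrite (set2C d a) (set2C c a) (set2C d b) (set2C c b).
by do 4 case: (_ \in B).
Qed.

Definition U24_free B := forall J a b c d, four_outside J a b c d ->
  ~ [/\ J :|: [set a; b] \in B /\ J :|: [set c; d] \in B,
        J :|: [set a; c] \in B, J :|: [set b; d] \in B,
        J :|: [set a; d] \in B & J :|: [set b; c] \in B].


Lemma four_outside_swap J a b c d :
  four_outside J a b c d -> four_outside J a c b d.
Proof.
rewrite /four_outside; congr (_ && _).
  by apply: perm_uniq; rewrite perm_cons (perm_catCA [:: b] [:: c] [:: d]).
by apply: perm_all; rewrite perm_cons (perm_catCA [:: b] [:: c] [:: d]).
Qed.

Lemma four_outside_rot J a b c d :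
  four_outside J a b c d -> four_outside J a c d b.
Proof.
rewrite /four_outside; congr (_ && _).
  by apply: perm_uniq; rewrite perm_cons (perm_catC [:: b] [:: c; d]).
by apply: perm_all; rewrite perm_cons (perm_catC [:: b] [:: c; d]).
Qed.

(** One direction of the comparison, for an ordered pair of matroids so that it can be used both
    ways. Exchange in [P] yields a splitting into nearer bases, which [Q] shares; exchange in [Q]
    then yields [Z] or the remaining mixed splitting, and the latter, carried back to [P], would
    complete a U_{2,4}. *)
Lemma bases_step P Q X Z :
  is_matroid_bases P -> is_matroid_bases Q -> U24_free P ->
  X \in P -> Z \in P -> 1 < #|Z :\: X| ->
  (forall Y, #|Y| = #|X| -> #|Y :\: X| < #|Z :\: X| -> (Y \in P) = (Y \in Q)) ->
  Z \in Q.
Proof.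
move=> mP mQ freeP XP ZP /card_gt1P[z [z' [zD z'D zz']]] agree.
have [_ exch] := mP.
(* Two successive exchanges towards [X] trade [z] and [z'] for [b] and [b'] in [X :\: Z]. *)
have [b] := exch _ _ ZP XP _ zD; rewrite inE => /andP[bZ bX] Z1P.
move: (zD) (z'D); rewrite !inE => /andP[zX zZ] /andP[z'X z'Z].
have z'b : z' != b by apply: contraNneq bZ => <-.
have zb : z != b by apply: contraNneq bZ => <-.
have z'1 : z' \in (b |: Z :\ z) :\: X by rewrite !inE z'X z'Z (eq_sym z' z) zz' orbT.
have [b'] := exch _ _ Z1P XP _ z'1.
rewrite !inE !negb_or negb_and negbK => /andP[/andP[b'b b'Z] b'X] Z2P.
have zb' : z != b' by apply: contraNneq zX => ->.
have z'b' : z' != b' by apply: contraNneq z'X => ->.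
move: b'Z; rewrite eq_sym (negPf zb') /= => b'Z.
set J := Z :\ z :\ z'.
have out : four_outside J z z' b b'.
  rewrite /four_outside /J /= !inE !negb_or zz' zb zb' z'b z'b' (eq_sym b) b'b.
  by rewrite !eqxx (negPf bZ) (negPf b'Z) !andbF.
have [[_ _] zJ z'J bJ b'J] := four_outsideP out.
have defZ : Z = J :|: [set z; z'].
  apply/setP=> w; rewrite !inE.
  case: (eqVneq w z') => [->|_]; first by rewrite z'Z !orbT.
  by case: (eqVneq w z) => [->|_]; rewrite ?zZ ?orbT ?orbF.
have defZ2 : b' |: (b |: Z :\ z) :\ z' = J :|: [set b; b'].
  apply/setP=> w; rewrite !inE.
  case: (eqVneq w z') => [->|_] /=; first by rewrite (negPf z'b) orbF.
  by rewrite orbC orbCA orbA.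
have JZ : {subset J <= Z} by move=> t; rewrite !inE => /and3P[].
rewrite defZ2 in Z2P; clearbody J.
(* The four mixed sets are strictly nearer to [X] than [Z] is: outside [X] they lie in [Z] and miss
   the other one of [z], [z']. So [agree] applies to them. *)
have agreeJ u w : u \in [set z; z'] -> w \in [set b; b'] ->
    (J :|: [set u; w] \in P) = (J :|: [set u; w] \in Q).
  move=> uz wb; have [uD uJ] : u \in Z :\: X /\ u \notin J.
    by case/set2P: uz => ->.
  have [wX wJ] : w \in X /\ w \notin J by case/set2P: wb => ->.
  have uw : u != w by apply: contraTneq uD => ->; rewrite inE wX.
  have cardY : #|J :|: [set u; w]| = #|X|.
    by rewrite card_setU2 // -(card_bases mP ZP XP) defZ card_setU2.
  apply: agree => //; apply: proper_card.
  have [u' u'Z u'Y] : exists2 u', u' \in Z :\: X & u' \notin J :|: [set u; w].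
    case/set2P: uz => ->; [exists z' | exists z] => //; rewrite !inE !negb_or.
      rewrite z'J eq_sym zz' /=; move: wX; apply: contraTneq => <-.
      by case/setDP: z'D.
    by rewrite zJ zz' /=; apply: contraTneq wX => <-.
  apply/properP; split; last by exists u' => //; rewrite inE negb_and u'Y orbT.
  apply/subsetP=> t; rewrite !inE => /andP[tX]; rewrite tX.
  case/or3P=> [/JZ//|/eqP->|/eqP tw]; first by case/setDP: uD.
  by rewrite tw wX in tX.
rewrite defZ in ZP.
case/orP: (pair_exchange mP out ZP Z2P) => /andP[P1 P2].
  move: (P1) (P2); rewrite !agreeJ ?inE ?eqxx ?orbT // => Q1 Q2.
  have := pair_exchange mQ (four_outside_swap out) Q1 Q2.
  rewrite -defZ => /orP[/andP[]//|/andP[Q3]]; rewrite set2C => Q4.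
  case: (freeP _ _ _ _ _ out); split=> //.
    by rewrite agreeJ // !inE eqxx ?orbT.
  by rewrite agreeJ // !inE eqxx ?orbT.
move: (P1) (P2); rewrite !agreeJ ?inE ?eqxx ?orbT // => Q1 Q2.
have out' : four_outside J z b' z' b by do 2 apply: four_outside_rot.
have := pair_exchange mQ out' Q1 Q2.
rewrite -defZ => /orP[/andP[]//|/andP[Q3]]; rewrite set2C => Q4.
case: (freeP _ _ _ _ _ out); split=> //.
  by rewrite agreeJ // !inE eqxx ?orbT.
by rewrite agreeJ // !inE eqxx ?orbT.
Qed.

(** Induction on the distance to [X]: distance 0 is [X] itself, distance 1 is the hypothesis on
    neighbours, and beyond that [bases_step] applies in both directions. *)
Lemma U24_free_eq P Q X :
  is_matroid_bases P -> is_matroid_bases Q -> U24_free P -> U24_free Q ->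
  X \in P -> X \in Q ->
  (forall x b, x \notin X -> b \in X ->
     (x |: X :\ b \in P) = (x |: X :\ b \in Q)) ->
  P = Q.
Proof.
move=> mP mQ fP fQ XP XQ near.
(* Sets of another size than [X] are bases of neither matroid. *)
suff agree Y : #|Y| = #|X| -> (Y \in P) = (Y \in Q).
  apply/setP=> Y; apply/idP/idP => YB.
    by rewrite -agree //; apply: card_bases mP _ _.
  by rewrite agree //; apply: card_bases mQ _ _.
have [n] := ubnP #|Y :\: X|; elim: n => // n IHn in Y *.
rewrite ltnS => leYn cardY.
have {leYn}IH Z : #|Z| = #|X| -> #|Z :\: X| < #|Y :\: X| -> (Z \in P) = (Z \in Q).
  by move=> cardZ ltZ; apply: IHn => //; apply: leq_trans leYn.
have [lt1|] := ltnP 1 #|Y :\: X|.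
  apply/idP/idP => YB; first exact: (bases_step mP mQ fP XP YB lt1).
  by apply: (bases_step mQ mP fQ XQ YB lt1) => Z cZ lZ; rewrite IH.
have eqD : #|Y :\: X| = #|X :\: Y|.
  by apply/eqP; rewrite -(eqn_add2l #|X :&: Y|) {1}setIC !cardsID cardY.
rewrite leq_eqVlt ltnS leqn0 => /orP[/eqP D1|].
  have /cards1P[x Dx] : #|Y :\: X| == 1 by rewrite D1.
  have /cards1P[b Db] : #|X :\: Y| == 1 by rewrite -eqD D1.
  have -> : Y = x |: X :\ b.
    apply/setP=> w; have /setP/(_ w) := Dx; have /setP/(_ w) := Db.
    rewrite !inE => <- <-.
    by case: (w \in X); case: (w \in Y).
  apply: near.
    by have := set11 x; rewrite -Dx inE => /andP[].
  by have := set11 b; rewrite -Db inE => /andP[].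
move=> D0; have -> : Y = X; last by rewrite XP XQ.
apply/eqP; rewrite eqEsubset -!setD_eq0.
by rewrite -!cards_eq0 -eqD D0.
Qed.

End Matroids.

(** * Spans and bases of a family of vectors *)

Section Representation.

Variables (T : finType) (F : fieldType) (r : nat) (v : T -> 'rV[F]_r).
Implicit Types (J S X Y : {set T}) (a b x y : T).

(** The row space of [rows_of v S], written as a sum over elements to avoid the enumeration of
    [S]. *)
Definition vspan S : 'M[F]_r := (\sum_(x in S) <<v x>>)%MS.

Lemma sub_vspan S x : x \in S -> (v x <= vspan S)%MS.
Proof. by move=> xS; rewrite (sumsmx_sup x) // genmxE. Qed.

Lemma vspan_sub S m (A : 'M[F]_(m, r)) :
  reflect {in S, forall x, (v x <= A)%MS} (vspan S <= A)%MS.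
Proof.
apply: (iffP sumsmx_subP) => sub x xS; first by rewrite -(genmxE (v x)) sub.
by rewrite genmxE sub.
Qed.

Lemma rows_of_span S : (rows_of v S :=: vspan S)%MS.
Proof.
apply/eqmxP/andP; split.
  apply/row_subP=> i; have -> : row i (rows_of v S) = v (enum_val i).
    by apply/rowP=> j; rewrite !mxE.
  exact/sub_vspan/enum_valP.
apply/vspan_sub=> x xS; have -> : v x = row (enum_rank_in xS x) (rows_of v S).
  by apply/rowP=> j; rewrite !mxE enum_rankK_in.
exact: row_sub.
Qed.

Lemma vspanS S X : S \subset X -> (vspan S <= vspan X)%MS.
Proof. by move=> /subsetP sSX; apply/vspan_sub=> x /sSX; apply: sub_vspan. Qed.

Lemma vspanU1 x S : (vspan (x |: S) :=: v x + vspan S)%MS.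
Proof.
apply/eqmxP/andP; split.
  apply/vspan_sub=> y /setU1P[->|yS]; first exact: addsmxSl.
  exact: submx_trans (sub_vspan yS) (addsmxSr _ _).
by rewrite addsmx_sub sub_vspan ?setU11 // vspanS // subsetUr.
Qed.

Lemma rank_vspanU1 x S :
  \rank (vspan (x |: S)) = (~~ (v x <= vspan S)%MS + \rank (vspan S))%N.
Proof.
rewrite vspanU1; have [xS|xS] := boolP (v x <= vspan S)%MS.
  by rewrite (addsmx_idPr xS).
apply/eqP; rewrite eqn_leq; apply/andP; split.
  apply: leq_trans (mxrank_adds_leqif _ _) _; rewrite leq_add2r.
  exact: rank_leq_row.
rewrite add1n (ltn_leqif (mxrank_leqif_sup (addsmxSr _ _))).
by rewrite addsmx_sub negb_and xS.
Qed.

Lemma rank_vspan_leq S : \rank (vspan S) <= #|S|.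
Proof.
by rewrite -rows_of_span rank_leq_row.
Qed.

Lemma vec_basesP S :
  reflect (\rank (vspan S) = #|S| /\ #|S| = \rank (vspan setT))
          (S \in vec_bases v).
Proof.
rewrite inE /row_free !rows_of_span.
by apply: (iffP andP) => [[/eqP-> /eqP] | [-> ->]].
Qed.

(** [X :\ b] is independent of rank one less than the full rank, so adding [x] gives a basis exactly
    when the rank goes up. *)
Lemma vec_base_exchange X x b : X \in vec_bases v -> b \in X -> x \notin X ->
  (x |: X :\ b \in vec_bases v) = ~~ (v x <= vspan (X :\ b))%MS.
Proof.
move=> /vec_basesP[rX cX] bX xX.
have rXb : \rank (vspan (X :\ b)) = #|X :\ b|.
  apply/eqP; rewrite eqn_leq rank_vspan_leq /=.
  have := rank_vspanU1 b (X :\ b); rewrite setD1K // rX (cardsD1 b) bX => /eqP.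
  by case: (~~ _) => // /eqP; rewrite ?add1n ?add0n; [case=> -> | move=> <-].
apply/vec_basesP/idP; rewrite card_exchange // -cX rank_vspanU1 rXb.
  by rewrite (cardsD1 b X) bX; case: (~~ _) => // [] [] /eqP; rewrite add0n add1n ltn_eqF.
by move=> ->; rewrite (cardsD1 b X) bX.
Qed.

Lemma vec_base_free X b : X \in vec_bases v -> b \in X ->
  ~~ (v b <= vspan (X :\ b))%MS.
Proof.
move=> /vec_basesP[rX cX] bX; apply/negP=> sub.
have := rank_vspanU1 b (X :\ b); rewrite setD1K // rX sub add0n => eqX.
by have := rank_vspan_leq (X :\ b); rewrite -eqX (cardsD1 b X) bX ltnn.
Qed.

Lemma vec_base_full X x : X \in vec_bases v -> (v x <= vspan X)%MS.
Proof.
move=> /vec_basesP[rX cX]; have := rank_vspanU1 x X.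
have : \rank (vspan (x |: X)) <= \rank (vspan setT) by rewrite mxrankS // vspanS // subsetT.
rewrite -cX -rX; case: (v x <= _)%MS => // le eq.
by rewrite eq add1n ltnn in le.
Qed.


(** Let [K] be a minimal subset of [Y] spanning [v x], so that [x |: K] is the fundamental circuit
    of [x] in [Y]. Some [y] in [K] escapes the span of [X :\ x], and any element of [K] can be
    traded for [x] in [Y]. *)
Lemma vec_bases_sym_exchange X Y x :
  X \in vec_bases v -> Y \in vec_bases v -> x \in X :\: Y ->
  exists2 y, y \in Y :\: X &
    (y |: X :\ x \in vec_bases v) && (x |: Y :\ y \in vec_bases v).
Proof.
move=> XB YB /setDP[xX xY].
pose inspan K := (v x <= vspan K)%MS.
have [K /minsetP[xK minK] KY] : {K | minset inspan K & K \subset Y}.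
  by apply: minset_exists; apply: vec_base_full.
have {}xK : (v x <= vspan K)%MS := xK.
have xX' := vec_base_free XB xX.
(* If all of [K] lay in the span of [X :\ x], so would [v x], against the independence of [X]. *)
have /existsP[y /andP[yK yX']] :
    [exists y, (y \in K) && ~~ (v y <= vspan (X :\ x))%MS].
  apply: contraR xX' => /existsPn none; apply: submx_trans xK _.
  by apply/vspan_sub=> y yK; have := none y; rewrite yK negbK.
have yY := subsetP KY _ yK.
have yx : y != x by apply: contraTneq yY => ->.
have yX : y \notin X.
  by apply: contra yX' => yX; rewrite sub_vspan // !inE yx.
exists y; first by rewrite inE yX.
rewrite !vec_base_exchange // yX' /=; apply/negP=> xY'.
have xK' : ~~ (v x <= vspan (K :\ y))%MS.
  apply/negP=> xK'; have /setP/(_ y) := minK _ xK' (subsetDl _ _).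
  by rewrite !inE eqxx yK.
have subK : (vspan (x |: K :\ y) <= vspan K)%MS.
  by rewrite vspanU1 addsmx_sub xK vspanS ?subsetDl.
have := vec_base_free YB yY; apply/negP; rewrite negbK.
have xKY : (vspan (x |: K :\ y) <= vspan (Y :\ y))%MS.
  by rewrite vspanU1 addsmx_sub xY' vspanS ?setSD.
apply: submx_trans xKY; apply: submx_trans (sub_vspan yK) _.
(* By minimality of [K], adding [x] to [K :\ y] raises the rank, hence restores the whole span of
   [K], including [v y]. *)
rewrite -(geq_leqif (mxrank_leqif_sup subK)) rank_vspanU1 xK'.
by rewrite -{1}(setD1K yK) rank_vspanU1 leq_add2r leq_b1.
Qed.

Lemma matroid_vec_bases X : X \in vec_bases v -> is_matroid_bases (vec_bases v).
Proof.
move=> XB; split; first by apply/set0Pn; exists X.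
move=> B1 B2 B1B B2B x xD.
by have [y yD /andP[yB _]] := vec_bases_sym_exchange B1B B2B xD; exists y.
Qed.

Lemma vspan_pair J a b :
  (vspan (J :|: [set a; b]) :=: v a + (v b + vspan J))%MS.
Proof.
rewrite setUC -setUA; apply: eqmx_trans (vspanU1 _ _) _.
exact: adds_eqmx (eqmx_refl _) (vspanU1 _ _).
Qed.

Lemma vec_base_pair J a b : a != b -> a \notin J -> b \notin J ->
  J :|: [set a; b] \in vec_bases v -> ~~ (v a <= v b + vspan J)%MS.
Proof.
move=> ab aJ bJ /vec_base_free/(_ (_ : a \in _)).
rewrite !inE eqxx orbT => /(_ isT).
have -> : (J :|: [set a; b]) :\ a = b |: J.
  apply/setP=> w; rewrite !inE.
  case: (eqVneq w a) => [->|_]; first by rewrite (negPf ab) (negPf aJ).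
  by rewrite orbC.
by rewrite vspanU1.
Qed.

End Representation.

(* Modulo the span of [J], both [v c] and [v d] are combinations of [v a] and
   [v b] with nonzero coefficients; over F_2 this forces [v c = v d]. *)
Lemma vec_bases_U24_free (T : finType) (r : nat) (v : T -> 'rV['F_2]_r) :
  U24_free (vec_bases v).
Proof.
move=> J a b c d /four_outsideP[[[ab ac ad bc bd] cd] aJ bJ cJ dJ].
case=> [[abB cdB] acB bdB adB bcB].
(* The choice of field enters here: the only nonzero coefficient is 1. *)
have F2 (u : 'M['F_2]_1) : (u != 0 -> u = 1%:M)%R.
  rewrite (mx11_scalar u); have [|] : (u 0 0 = 0 \/ u 0 0 = 1)%R.
    by case: (u 0 0)%R => [[|[|[]]]] // i; [left | right]; apply: val_inj.
  - by move=> ->; rewrite raddf0 eqxx.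
  - by move=> ->.
(* Modulo the span of [J], [v e] is a combination of [v a] and [v b]; a zero coefficient would make
   [e] dependent on [J] and one of [a], [b]. Hence it is their sum, for [e = c] and for [e = d]. *)
have sum_ab e : e != a -> e != b -> e \notin J ->
    J :|: [set e; a] \in vec_bases v -> J :|: [set e; b] \in vec_bases v ->
    ((v e - (v a + v b))%R <= vspan v J)%MS.
  move=> ea eb eJ eaB ebB.
  have := vec_base_full e abB; rewrite vspan_pair => /sub_addsmxP[[u w]] /= eq_e.
  have /sub_addsmxP[[u' w'] /= eq_w] : ((w *m (v b + vspan v J)%MS)%R <= v b + vspan v J)%MS.
    exact: submxMl.
  move: eq_e; rewrite eq_w => eq_e.
  have u1 : u = 1%:M%R.
    apply: F2; apply: contraNneq (vec_base_pair eb eJ bJ ebB) => u0.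
    by rewrite eq_e u0 mul0mx add0r addmx_sub_adds ?submxMl.
  have u'1 : u' = 1%:M%R.
    apply: F2; apply: contraNneq (vec_base_pair ea eJ aJ eaB) => u0.
    by rewrite eq_e u0 mul0mx add0r addmx_sub_adds ?submxMl.
  by rewrite eq_e u1 u'1 !mul1mx [(v a + (_ + _))%R]addrA [X in (X <= _)%MS]addrC addKr submxMl.
have ca : c != a by rewrite eq_sym.
have cb : c != b by rewrite eq_sym.
have da : d != a by rewrite eq_sym.
have db : d != b by rewrite eq_sym.
rewrite set2C in acB; rewrite set2C in bcB; rewrite set2C in adB.
rewrite set2C in bdB.
have cC := sum_ab c ca cb cJ acB bcB; have dC := sum_ab d da db dJ adB bdB.
have := vec_base_pair cd cJ dJ cdB; apply/negP; rewrite negbK.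
have -> : v c = (v d + ((v c - (v a + v b)) - (v d - (v a + v b))))%R.
  by rewrite opprB addrC addrA !subrK.
by rewrite addmx_sub_adds // addmx_sub ?eqmx_opp.
Qed.
(** Vectors vanishing at [j] form a subspace, the kernel of the column [delta_mx j ord0]. *)
Lemma vspan_coord0 (T : finType) (F : fieldType) (r : nat) (v : T -> 'rV[F]_r)
    (S : {set T}) (j : 'I_r) (u : 'rV[F]_r) :
  {in S, forall x, v x ord0 j = 0%R} -> (u <= vspan v S)%MS -> u ord0 j = 0%R.
Proof.
move=> v0 uS.
have /(submx_trans uS)/sub_kermxP : (vspan v S <= kermx (delta_mx j (ord0 : 'I_1)))%MS.
  apply/vspan_sub=> x xS; apply/sub_kermxP; rewrite -colE.
  by apply/colP=> i; rewrite !mxE (ord1 i) v0.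
by rewrite -colE => /colP/(_ ord0); rewrite !mxE.
Qed.

(** * The binary matroid built from the fundamental circuits of a basis *)

Section FundamentalCircuits.

Variables (T : finType) (B : {set {set T}}) (X : {set T}).
Hypotheses (matB : is_matroid_bases B) (XB : X \in B).

(* For [x] in [X] this is a unit vector: [x |: X :\ b] is too small to be a
   basis unless [b = x]. *)
Definition circuit_row (x : T) : 'rV['F_2]_#|T| :=
  (\row_j ((enum_val j \in X) && (x |: X :\ enum_val j \in B))%:R)%R.

Lemma circuit_rowE x b :
  circuit_row x ord0 (enum_rank b) = ((b \in X) && (x |: X :\ b \in B))%:R%R.
Proof. by rewrite mxE enum_rankK. Qed.

Lemma circuit_row_base x b : x \in X -> b \in X ->
  (x |: X :\ b \in B) = (x == b).
Proof.
move=> xX bX; case: eqVneq => [->|xb]; first by rewrite setD1K.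
apply: contraNF (negbT (ltnn #|X|)) => inB.
rewrite {1}(card_bases matB XB inB).
have -> : x |: X :\ b = X :\ b by apply/setUidPr; rewrite sub1set !inE xb.
by rewrite [in X in _ < X](cardsD1 b X) bX.
Qed.

(** The rows of elements of [X] are unit vectors, and a vector over F_2 is the sum of the unit
    vectors on its support. *)
Lemma circuit_row_sum x :
  circuit_row x = (\sum_(b in X | x |: X :\ b \in B) circuit_row b)%R.
Proof.
apply/rowP=> j; rewrite -(enum_valK j); move: (enum_val j) => b.
rewrite circuit_rowE summxE.
have [bX|bX] := boolP (b \in X); last first.
  by rewrite big1 // => c _; rewrite circuit_rowE (negPf bX).
have circ c : c \in X -> circuit_row c ord0 (enum_rank b) = (c == b)%:R%R.
  by move=> cX; rewrite circuit_rowE bX circuit_row_base.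
have [inB|ninB] := boolP (x |: X :\ b \in B).
  rewrite (bigD1 b) ?bX ?inB //= circ // eqxx big1 ?addr0 // => c.
  by case/andP=> /andP[cX _] /negPf cb; rewrite circ // cb.
rewrite big1 // => c /andP[cX cB]; rewrite circ //.
by case: eqVneq cB ninB => // -> ->.
Qed.

Lemma circuit_row_free (S : {set T}) x : S \subset X -> x \in X -> x \notin S ->
  ~~ (circuit_row x <= vspan circuit_row S)%MS.
Proof.
move=> /subsetP SX xX xS; apply/negP => inS.
have : circuit_row x ord0 (enum_rank x) = 0%R.
  apply: vspan_coord0 inS => y yS.
  rewrite circuit_rowE xX (circuit_row_base (SX _ yS)) //.
  by case: eqVneq yS xS => // -> ->.
by rewrite circuit_rowE xX circuit_row_base // eqxx => /eqP; rewrite oner_eq0.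
Qed.

Lemma circuit_row_vec_base : X \in vec_bases circuit_row.
Proof.
have rank (S : {set T}) : S \subset X -> \rank (vspan circuit_row S) = #|S|.
  have [n] := ubnP #|S|; elim: n => // n IHn in S *.
  have [->|[x xS]] := set_0Vmem S.
    by move=> _ _; apply/eqP; rewrite eqn_leq rank_vspan_leq cards0.
  rewrite (cardsD1 x) xS ltnS => ltn SX.
  have S'X : S :\ x \subset X := subset_trans (subsetDl _ _) SX.
  rewrite -{1}(setD1K xS) rank_vspanU1 IHn // circuit_row_free //.
    exact: (subsetP SX).
  by rewrite !inE eqxx.
apply/vec_basesP; split; first exact: rank.
rewrite -rank //; apply/eqP; rewrite eqn_leq mxrankS ?vspanS ?subsetT //=.
apply/mxrankS/vspan_sub=> x _; rewrite circuit_row_sum.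
by apply: summx_sub => b /andP[bX _]; apply: sub_vspan.
Qed.

(** Both sides read the coordinate of [circuit_row x] at [b]. The rows of [X :\ b] all vanish there,
    so a 1 keeps [x] out of their span; with a 0, [circuit_row_sum] does not involve [b]. *)
Lemma circuit_row_near x b : x \notin X -> b \in X ->
  (x |: X :\ b \in B) = (x |: X :\ b \in vec_bases circuit_row).
Proof.
move=> xX bX; rewrite vec_base_exchange ?circuit_row_vec_base //.
apply/idP/negP => [inB sub|].
  have : circuit_row x ord0 (enum_rank b) = 0%R.
    apply: vspan_coord0 sub => y /setD1P[yb yX].
    by rewrite circuit_rowE circuit_row_base // (negPf yb) andbF.
  by rewrite circuit_rowE bX inB => /eqP; rewrite oner_eq0.
move/negP; apply: contraNT => ninB; rewrite circuit_row_sum.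
apply: summx_sub => c /andP[cX cB]; apply: sub_vspan.
by rewrite !inE cX andbT; apply: contraNneq ninB => <-.
Qed.

End FundamentalCircuits.

(** The matroid of the circuit rows shares with [B] the basis [X] and all bases one exchange away.
    It is itself free of U_{2,4}, being represented over F_2, so the two coincide. *)
Lemma U24_free_binary (T : finType) (B : {set {set T}}) :
  is_matroid_bases B -> U24_free B -> binary B.
Proof.
move=> matB freeB; have [/set0Pn[X XB] _] := matB.
exists #|T|, (circuit_row B X).
have XV := circuit_row_vec_base matB XB.
have freeV := @vec_bases_U24_free _ _ (circuit_row B X).
apply: (U24_free_eq matB (matroid_vec_bases XV) freeB freeV XB XV) => x b xX bX.
exact: circuit_row_near.
Qed.

(** * Counting the pairs of bases with a given multiset union *)

Section Delta.

Variable T : finType.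
Implicit Types (B : {set {set T}}) (J X Y D : {set T}) (a b c d x y : T).

Definition exchange_pairs B X Y :=
  [set [set D1; D2] | D1 in B, D2 in B & multiset_union_eq D1 D2 X Y].

Lemma exchange_pairsP B X Y P :
  reflect (exists D1 D2, [/\ D1 \in B, D2 \in B, multiset_union_eq D1 D2 X Y
                           & P = [set D1; D2]])
          (P \in exchange_pairs B X Y).
Proof.
apply: (iffP imset2P) => [[D1 D2 D1B]|[D1 [D2 [D1B D2B eqD ->]]]].
  by rewrite inE => /andP[D2B eqD] ->; exists D1, D2.
by exists D1 D2; rewrite ?inE ?D2B.
Qed.

Lemma multiset_union_eqC D D' X Y :
  multiset_union_eq D D' X Y = multiset_union_eq D' D X Y.
Proof. by apply: eq_forallb => x; rewrite addnC. Qed.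

Lemma multiset_union_eq_inj D D1 D2 X Y :
  multiset_union_eq D D1 X Y -> multiset_union_eq D D2 X Y -> D1 = D2.
Proof.
move=> /forallP eq1 /forallP eq2; apply/setP=> x; apply/eqP.
have := eq1 x; rewrite -(eqP (eq2 x)) eqn_add2l.
by case: (x \in D1); case: (x \in D2).
Qed.

(** If [D1] contains [X :\: Y], it contains [X] and equals it by size. Otherwise it misses the only
    element of [X :\: Y], so it lies in [Y] and equals it. Either way the pair is [[set X; Y]]. *)
Lemma Delta_le1 B X Y : is_matroid_bases B -> X \in B -> Y \in B ->
  #|X :\: Y| <= 1 -> Delta B X Y <= 1.
Proof.
move=> mB XB YB le1; rewrite -(cards1 [set X; Y]); apply: subset_leq_card.
apply/subsetP=> _ /exchange_pairsP[D1 [D2 [D1B D2B eqD ->]]]; rewrite inE.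
have eq_refl : multiset_union_eq X Y X Y by apply/forallP.
have [sXD|] := boolP (X :\: Y \subset D1).
  have XD : X = D1.
    apply/eqP; rewrite eqEcard (card_bases mB D1B XB) leqnn andbT.
    apply/subsetP=> x xX; have [xY|xY] := boolP (x \in Y).
      have /forallP/(_ x) := eqD; rewrite xX xY.
      by case: (x \in D1); case: (x \in D2).
    by apply: (subsetP sXD); rewrite inE xY.
  by rewrite -XD in eqD *; rewrite (multiset_union_eq_inj eqD eq_refl).
case/subsetPn=> a aXY aD1.
have defXY : X :\: Y = [set a].
  by apply/esym/eqP; rewrite eqEcard sub1set aXY cards1.
have YD : D1 = Y.
  apply/eqP; rewrite eqEcard (card_bases mB D1B YB) leqnn andbT.
  apply/subsetP=> x xD1; apply: contraR aD1 => xY.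
  suff: x \in X :\: Y by rewrite defXY => /set1P<-.
  rewrite inE xY; have /forallP/(_ x) := eqD; rewrite xD1 (negPf xY).
  by case: (x \in X).
rewrite YD multiset_union_eqC in eqD *; rewrite multiset_union_eqC in eqD.
have eq_refl' : multiset_union_eq Y X X Y by rewrite multiset_union_eqC.
by rewrite (multiset_union_eq_inj eqD eq_refl') set2C.
Qed.

Lemma multiset_union_eq_pairs J a b c d : four_outside J a b c d ->
  multiset_union_eq (J :|: [set a; c]) (J :|: [set b; d])
                    (J :|: [set a; b]) (J :|: [set c; d]).
Proof.
move=> /four_outsideP[[[/negPf ab /negPf ac /negPf ad /negPf bc /negPf bd] /negPf cd] _ _ _ _].
apply/forallP=> x; rewrite !inE; case: (x \in J) => //=.
case: (eqVneq x a) => [->|_]; first by rewrite ab ac ad.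
case: (eqVneq x b) => [->|_]; first by rewrite bc bd.
by case: (eqVneq x c) => [->|_]; rewrite ?cd.
Qed.

Definition U24_pairs J a b c d :=
  [set [set J :|: [set a; b]; J :|: [set c; d]];
       [set J :|: [set a; c]; J :|: [set b; d]];
       [set J :|: [set a; d]; J :|: [set b; c]]].

Lemma pair_neq J a b c d : four_outside J a b c d ->
  [set J :|: [set a; b]; J :|: [set c; d]] !=
  [set J :|: [set a; c]; J :|: [set b; d]].
Proof.
move=> /four_outsideP[[[ab ac ad bc bd] cd] aJ bJ cJ dJ].
apply: contraTneq (set21 (J :|: [set a; b]) (J :|: [set c; d])) => ->.
rewrite !inE negb_or; apply/andP; split; apply/eqP.
  move/setP/(_ b); rewrite !inE eqxx orbT (negPf bJ) (negPf bc) eq_sym.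
  by rewrite (negPf ab) orbT.
by move/setP/(_ a); rewrite !inE eqxx orbT (negPf aJ) (negPf ab) (negPf ad).
Qed.

Lemma card_U24_pairs J a b c d :
  four_outside J a b c d -> #|U24_pairs J a b c d| = 3.
Proof.
move=> out; have outr := four_outside_rot out.
have := pair_neq outr; rewrite (set2C d b) (set2C c b) => neq23.
have := pair_neq (four_outside_swap (four_outside_rot outr)).
rewrite (set2C d c) => neq13.
rewrite /U24_pairs -setUA cardsU1 cards2 !inE neq23.
by rewrite (negPf (pair_neq out)) (negPf neq13).
Qed.

(** The member containing [a] consists of [J], [a] and, by its size, one further element [q] among
    [b], [c], [d]; it determines the other member. *)
Lemma sub_exchange_pairs B J a b c d : four_outside J a b c d ->
  is_matroid_bases B -> J :|: [set a; b] \in B ->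
  exchange_pairs B (J :|: [set a; b]) (J :|: [set c; d]) \subset U24_pairs J a b c d.
Proof.
move=> out mB abB.
apply/subsetP=> _ /exchange_pairsP[D1 [D2 [D1B D2B eqD ->]]].
have outP := four_outsideP out.
case: outP => [[[ab ac ad bc bd] cd] aJ bJ cJ dJ].
wlog aD1 : D1 D2 D1B D2B eqD / a \in D1.
  move=> th; have [aD1|aD1] := boolP (a \in D1); first exact: th.
  rewrite set2C; apply: th; rewrite // 1?multiset_union_eqC //.
  have /forallP/(_ a) := eqD; rewrite (negPf aD1) !inE eqxx orbT (negPf aJ).
  by rewrite (negPf ac) (negPf ad); case: (a \in D2).
have cD1 : #|D1| = #|J|.+2 by rewrite (card_bases mB D1B abB) card_setU2.
(* Elements of [J] have multiplicity two, so they belong to both members. *)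
have JD1 x : x \in J -> x \in D1.
  move=> xJ; have /forallP/(_ x) := eqD; rewrite !inE xJ /=.
  by case: (x \in D1); case: (x \in D2).
have JD : J \subset D1 by apply/subsetP.
have /cards1P[q Dq] : #|D1 :\: J :\ a| == 1.
  have := cardsD1 a (D1 :\: J); rewrite inE aJ aD1 /= => /eqP.
  by rewrite cardsD (setIidPr JD) cD1 subSn // subSnn eqSS eq_sym.
have /setD1P[qa /setDP[qD1 qJ]] : q \in D1 :\: J :\ a by rewrite Dq set11.
have {}Dq : D1 = J :|: [set a; q].
  apply/setP=> x; have /setP/(_ x) := Dq; rewrite !inE => <-.
  have [->|_] := eqVneq x a; first by rewrite aD1 orbT.
  by have := @JD1 x; case: (x \in J) => //= ->.
have q_bcd : [|| q == b, q == c | q == d].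
  have /forallP/(_ q) := eqD; rewrite qD1 !inE (negPf qJ) (negPf qa) /=.
  by case: (q == b); case: (q == c); case: (q == d).
rewrite {}Dq in eqD *; rewrite !inE.
case/or3P: q_bcd => /eqP qE; rewrite {}qE in eqD *.
- have eq_refl : multiset_union_eq (J :|: [set a; b]) (J :|: [set c; d])
    (J :|: [set a; b]) (J :|: [set c; d]) by apply/forallP.
  by rewrite (multiset_union_eq_inj eqD eq_refl) eqxx.
- by rewrite (multiset_union_eq_inj eqD (multiset_union_eq_pairs out)) eqxx orbT.
have out' := four_outside_swap (four_outside_rot (four_outside_rot out)).
have := multiset_union_eq_pairs out'; rewrite (set2C d c) => eqD'.
by rewrite (multiset_union_eq_inj eqD eqD') eqxx !orbT.
Qed.

(** The counted pairs are among three distinct splittings, so the count is 3 exactly when every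
    splitting consists of bases. *)
Lemma Delta_U24 B J a b c d : four_outside J a b c d ->
  is_matroid_bases B -> J :|: [set a; b] \in B ->
  Delta B (J :|: [set a; b]) (J :|: [set c; d]) = 3 <->
  [/\ J :|: [set a; b] \in B /\ J :|: [set c; d] \in B,
      J :|: [set a; c] \in B, J :|: [set b; d] \in B,
      J :|: [set a; d] \in B & J :|: [set b; c] \in B].
Proof.
move=> out mB abB; have sub := sub_exchange_pairs out mB abB.
rewrite /Delta -/(exchange_pairs _ _ _); split=> [card3|[[_ cdB] acB bdB adB bcB]].
  have eqP3 : exchange_pairs B (J :|: [set a; b]) (J :|: [set c; d]) =
    U24_pairs J a b c d.
    by apply/eqP; rewrite eqEcard sub card_U24_pairs // card3.
  have pairB Y Z : [set Y; Z] \in U24_pairs J a b c d -> Y \in B /\ Z \in B.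
    rewrite -eqP3 => /exchange_pairsP[D1 [D2 [D1B D2B _ eqYZ]]].
    have inB W : W \in [set Y; Z] -> W \in B by rewrite eqYZ => /set2P[]->.
    by split; apply: inB; rewrite ?set21 ?set22.
  have [] := pairB (J :|: [set a; b]) (J :|: [set c; d]).
    by rewrite !inE eqxx.
  have [] := pairB (J :|: [set a; c]) (J :|: [set b; d]).
    by rewrite !inE eqxx orbT.
  have [] := pairB (J :|: [set a; d]) (J :|: [set b; c]).
    by rewrite !inE eqxx !orbT.
  by [].
rewrite -(card_U24_pairs out); congr #|pred_of_set _|; apply/eqP.
rewrite eqEsubset sub; apply/subsetP=> P; rewrite !inE.
case/orP=> [/orP[]|] /eqP->; apply/exchange_pairsP.
- by do 2 eexists; split; last reflexivity; rewrite //; apply/forallP.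
- do 2 eexists; split; last reflexivity; rewrite //.
  exact: multiset_union_eq_pairs.
do 2 eexists; split; last reflexivity; rewrite //.
have out' := four_outside_swap (four_outside_rot (four_outside_rot out)).
by have := multiset_union_eq_pairs out'; rewrite (set2C d c).
Qed.

Lemma multiset_union_eq_exchange X Y x y : x \in X :\: Y -> y \in Y :\: X ->
  multiset_union_eq (y |: X :\ x) (x |: Y :\ y) X Y.
Proof.
move=> /setDP[xX xY] /setDP[yY yX]; apply/forallP=> w.
have xy : x != y by apply: contraNneq xY => ->.
rewrite !inE; have [->|_] := eqVneq w x; first by rewrite (negPf xy) xX (negPf xY).
by have [->|_] := eqVneq w y; first by rewrite yY (negPf yX).
Qed.

(** The original pair and the symmetric exchanges of the elements of [X :\: Y] give [#|X :\: Y| + 1]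
    pairs; a third element of [X :\: Y] serves to tell them apart. *)
Lemma Delta_ge B X Y : X \in B -> Y \in B -> 2 < #|X :\: Y| ->
  (forall x, x \in X :\: Y -> exists2 y, y \in Y :\: X &
     (y |: X :\ x \in B) && (x |: Y :\ y \in B)) ->
  #|X :\: Y| < Delta B X Y.
Proof.
move=> XB YB gt2 exch.
(* The default [x] is never reached on [X :\: Y], where [exch] makes the search succeed. *)
pose partner x := odflt x
  [pick y in Y :\: X | (y |: X :\ x \in B) && (x |: Y :\ y \in B)].
pose pair x := [set partner x |: X :\ x; x |: Y :\ partner x].
have partnerP x : x \in X :\: Y ->
    [/\ partner x \in Y :\: X, partner x |: X :\ x \in B
      & x |: Y :\ partner x \in B].
  move=> /exch[y yD yB]; rewrite /partner; case: pickP => [z|/(_ y)] /=.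
    by case/and3P.
  by rewrite yD yB.
have x_partner x : x \in X :\: Y -> x != partner x.
  move=> xD; have [/setDP[pY _] _ _] := partnerP x xD.
  by case/setDP: xD => _; apply: contraNneq => {1}->.
(* Such a [w] stays on the side of [X] in the exchanges of [x] and [z], so it shows which members of
   two equal pairs would correspond. *)
have third x z : exists2 w, w \in X :\: Y & (w != x) && (w != z).
  have : X :\: Y :\: [set x; z] != set0.
    rewrite -card_gt0 cardsD subn_gt0; apply: leq_ltn_trans gt2.
    by rewrite (leq_trans (subset_leq_card (subsetIr _ _))) // cards2; case: (_ != _).
  by case/set0Pn=> w /setDP[wD]; rewrite !inE negb_or; exists w.
have XYpair x : x \in X :\: Y -> [set X; Y] != pair x.
  move=> xD; have [w /setDP[wX wY] /andP[wx _]] := third x x.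
  have [/setDP[pY pX] _ _] := partnerP x xD; have [xX xY] := setDP xD.
  apply: contraTneq (set21 (partner x |: X :\ x) (x |: Y :\ partner x)).
  rewrite -/(pair x) => <-; rewrite !inE negb_or; apply/andP; split; apply/eqP.
    by move/setP/(_ x); rewrite !inE eqxx xX (negPf (x_partner x xD)).
  by move/setP/(_ w); rewrite !inE wx wX (negPf wY) orbT.
have pair_inj : {in X :\: Y &, injective pair}.
  move=> x z xD zD eq_pair; apply/eqP; apply: contraT => xz.
  have [w /setDP[wX wY] /andP[wx wz]] := third x z.
  have [/setDP[pY pX] _ _] := partnerP x xD; have [xX xY] := setDP xD.
  have [/setDP[qY qX] _ _] := partnerP z zD.
  have := set21 (partner x |: X :\ x) (x |: Y :\ partner x).
  rewrite -/(pair x) eq_pair => /set2P[] /setP.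
    by move/(_ x); rewrite !inE eqxx xX xz orbT (negPf (x_partner x xD)).
  by move/(_ w); rewrite !inE wx wX (negPf wY) (negPf wz) andbF orbT.
rewrite -(card_in_imset pair_inj).
have notin : [set X; Y] \notin pair @: (X :\: Y).
  by apply/imsetP=> -[x xD eqp]; have := XYpair x xD; rewrite eqp eqxx.
have := cardsU1 [set X; Y] (pair @: (X :\: Y)); rewrite notin add1n => <-.
apply: subset_leq_card; apply/subsetP=> P; case/setU1P=> [->|/imsetP[x xD ->]].
  by apply/exchange_pairsP; exists X, Y; split=> //; apply/forallP.
have [pD p1 p2] := partnerP x xD; apply/exchange_pairsP.
by do 2 eexists; split; last reflexivity; rewrite // multiset_union_eq_exchange.
Qed.

End Delta.

Theorem theorem3p4 (T : finType) (B : {set {set T}}) :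
  is_matroid_bases B ->
  (binary B <-> forall B1 B2, B1 \in B -> B2 \in B -> Delta B B1 B2 <> 3%N).
Proof.
move=> matB; split; last first.
  (* Six bases forming a U_{2,4} would give [Delta] the value 3 at two complementary ones. *)
  move=> Delta3; apply: U24_free_binary => // J a b c d out six.
  have [[abB cdB] _ _ _ _] := six.
  by apply: (Delta3 _ _ abB cdB); apply/(Delta_U24 out).
case=> r [v defB] B1 B2 B1B B2B Delta3.
have [le1|] := leqP #|B1 :\: B2| 1.
  by have := Delta_le1 matB B1B B2B le1; rewrite Delta3.
rewrite leq_eqVlt => /orP[/eqP card2|gt2]; last first.
  have exch x : x \in B1 :\: B2 -> exists2 y, y \in B2 :\: B1 &
      (y |: B1 :\ x \in B) && (x |: B2 :\ y \in B).
    by rewrite defB in B1B B2B *; apply: vec_bases_sym_exchange.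
  (* A difference of size at least 3 forces [Delta] to be at least 4. *)
  by have := Delta_ge B1B B2B gt2 exch; rewrite Delta3 ltnS leqNgt gt2.
have /cards2P[a [b [ab defab]]] : #|B1 :\: B2| == 2 by rewrite -card2.
have /cards2P[c [d [cd defcd]]] : #|B2 :\: B1| == 2.
  rewrite -(eqn_add2l #|B2 :&: B1|) cardsID setIC card2 cardsID.
  by rewrite (card_bases matB B1B B2B).
have defB1 : B1 = B1 :&: B2 :|: [set a; b] by rewrite -defab setID.
have defB2 : B2 = B1 :&: B2 :|: [set c; d] by rewrite -defcd setIC setID.
have out : four_outside (B1 :&: B2) a b c d.
  have /setDP[a1 a2] : a \in B1 :\: B2 by rewrite defab set21.
  have /setDP[b1 b2] : b \in B1 :\: B2 by rewrite defab set22.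
  have /setDP[c2 c1] : c \in B2 :\: B1 by rewrite defcd set21.
  have /setDP[d2 d1] : d \in B2 :\: B1 by rewrite defcd set22.
  rewrite /four_outside /= !inE !negb_or ab cd.
  rewrite (negPf a2) (negPf b2) (negPf c1) (negPf d1) !andbF /= !andbT.
  have neq x z : x \notin B2 -> z \in B2 -> x != z.
    by move=> xB2 zB2; apply: contraNneq xB2 => ->.
  by rewrite !neq.
have := Delta_U24 out matB; rewrite -defB1 -defB2 => /(_ B1B)[/(_ Delta3) six _].
by apply: (vec_bases_U24_free (v := v) out); rewrite -defB -defB1 -defB2.
Qed.
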